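(* Let $n\ge 5$ and let $G$ be a $\mathcal{B}$ graph on $n$ vertices such that it is not the case that $n$ is even and $G\cong A_n$. Then $G$ is pancyclic.
   Context: For $n\ge 5$, the bicycle wheel $B_n$ is the graph with $n$ vertices consisting of a rim cycle on $n-2$ vertices, two hub vertices each adjacent to every rim vertex, and an edge joining the two hubs. A $\mathcal{B}$ graph is a graph that is either $B_n$ for some $n\ge 5$, or a $3$-connected non-planar graph obtained from $B_n$ by deleting edges. For $n\ge 6$, $A_n$ is the graph consisting of a rim cycle $1,2,\dots,n-2,1$, two further vertices $u,w$ joined by an edge, with $u$ adjacent exactly to the odd-labelled rim vertices and $w$ adjacent exactly to the even-labelled rim vertices. A graph on $n$ vertices is pancyclic if it has a cycle of every length from $3$ to $n$. *)

(* Defs.v *)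
From HB Require Import structures.
From mathcomp Require Import all_boot all_order all_algebra.
From mathcomp Require Import all_classical all_reals.
From mathcomp Require Import topology normedtype.

Set Implicit Arguments.
Unset Strict Implicit.
Unset Printing Implicit Defensive.

Import Order.TTheory GRing.Theory Num.Theory.
Import numFieldNormedType.Exports.

Record sgraph := SGraph {
  svertex :> finType;
  sedge : rel svertex;
  sedge_sym : symmetric sedge;
  sedge_irrefl : irreflexive sedge
}.

Notation "x -- y" := (sedge x y) (at level 30).

Definition sg_iso (G H : sgraph) : Prop :=
  exists2 f : G -> H, bijective f & forall x y : G, f x -- f y = x -- y.

Definition edges (G : sgraph) : {set {set G}} :=
  [set [set p.1; p.2] | p in [set p : G * G | p.1 -- p.2]].

Section DeleteEdges.
Variables (G : sgraph) (F : {set {set G}}).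

Definition del_rel : rel G := [rel x y | (x -- y) && ([set x; y] \notin F)].

Lemma del_rel_sym : symmetric del_rel.
Proof. by move=> x y; rewrite /del_rel /= sedge_sym finset.setUC. Qed.

Lemma del_rel_irrefl : irreflexive del_rel.
Proof. by move=> x; rewrite /del_rel /= sedge_irrefl. Qed.

Definition del_edges : sgraph := SGraph del_rel_sym del_rel_irrefl.

End DeleteEdges.

Definition connected_avoiding (G : sgraph) (X : {set G}) : Prop :=
  forall x y : G, x \notin X -> y \notin X ->
    connect [rel a b | [&& a -- b, a \notin X & b \notin X]] x y.

Definition k_connected (k : nat) (G : sgraph) : Prop :=
  k < #|G| /\ forall X : {set G}, #|X| < k -> connected_avoiding X.

Definition graph_cycle (G : sgraph) (c : seq G) : Prop :=
  3 <= size c /\ ucycle (@sedge G) c.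

Definition pancyclic (G : sgraph) : Prop :=
  forall k, 3 <= k <= #|G| -> exists2 c : seq G, graph_cycle c & size c = k.

Section Planarity.
Local Open Scope ring_scope.

(* A drawing in the plane: vertex x is placed at [pt x] and the edge xy is the
   arc [arc x y], parametrised by [0, 1] from x to y ([arc y x] is the same
   arc traversed backwards); arcs meet only at common end vertices. *)
Definition planar_drawing (R : realType) (G : sgraph)
    (pt : G -> R * R) (arc : G -> G -> R -> R * R) : Prop :=
  [/\ injective pt,
      forall x y : G, x -- y ->
        [/\ {within `[0, 1], continuous (arc x y)}%classic,
            {in `[0, 1] &, injective (arc x y)},
            arc x y 0 = pt x, arc x y 1 = pt y
          & forall t : R, t \in `[0, 1] -> arc y x t = arc x y (1 - t)],
      forall x y z : G, x -- y ->
        forall t : R, t \in `]0, 1[ -> arc x y t <> pt z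
    & forall x y x' y' : G, x -- y -> x' -- y' -> [set x; y] != [set x'; y'] ->
        forall t t' : R, t \in `]0, 1[ -> t' \in `]0, 1[ ->
          arc x y t <> arc x' y' t'].

Definition planar (R : realType) (G : sgraph) : Prop :=
  exists (pt : G -> R * R) (arc : G -> G -> R -> R * R), planar_drawing pt arc.

End Planarity.

(* The vertices of the graphs below are the n - 2 rim vertices [inl i] and the
   two hubs [inr true], [inr false].  The conjunct [i != j] only matters for
   n = 3, where it excludes a loop. *)
Definition rim_rel (m : nat) : rel 'I_m :=
  [rel i j : 'I_m |
    (i != j) && ((j == i.+1 %% m :> nat) || (i == j.+1 %% m :> nat))].

Section RimAndHubs.
Variables (m : nat) (spoke : 'I_m -> bool -> bool).

Definition hubbed_rel (x y : 'I_m + bool) : bool :=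
  match x, y with
  | inl i, inl j => rim_rel i j
  | inl i, inr b => spoke i b
  | inr b, inl i => spoke i b
  | inr b, inr b' => b != b'
  end.

Lemma hubbed_rel_sym : symmetric hubbed_rel.
Proof.
by move=> [i|b] [j|b'] //=; rewrite /rim_rel /= eq_sym // orbC.
Qed.

Lemma hubbed_rel_irrefl : irreflexive hubbed_rel.
Proof. by move=> [i|b] /=; rewrite /rim_rel /= eqxx. Qed.

Definition hubbed_cycle : sgraph := SGraph hubbed_rel_sym hubbed_rel_irrefl.

End RimAndHubs.

Definition bicycle_wheel (n : nat) : sgraph :=
  hubbed_cycle (fun (_ : 'I_(n - 2)) _ => true).

(* The rim vertex [inl i] carries the label i + 1, so that labels run from 1
   to n - 2; [inr true] is u (odd labels), [inr false] is w (even labels). *)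
Definition alternating_wheel (n : nat) : sgraph :=
  hubbed_cycle (fun (i : 'I_(n - 2)) b => odd i.+1 == b).

Definition B_graph (R : realType) (G : sgraph) : Prop :=
  exists2 n : nat, 5 <= n &
    sg_iso G (bicycle_wheel n) \/
    [/\ k_connected 3 G, ~ planar R G
      & exists2 F : {set {set bicycle_wheel n}}, F \subset edges (bicycle_wheel n)
        & sg_iso G (del_edges F)].

(* Main.v *)
Require Import Defs.
From mathcomp Require Import all_boot all_order all_algebra.
From mathcomp Require Import all_classical all_reals.
From mathcomp Require Import topology normedtype.
From mathcomp Require Import zify ring lra.

(** A spanning subgraph of the bicycle wheel that misses the hub edge or a rim
    edge has a straight-line drawing, so a non-planar one keeps the whole rim
    and the hub edge; 3-connectivity gives every rim vertex and every hub a
    spoke.  Let [U] and [W] be the rim neighbourhoods of the hubs.  A rim arc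
    with [d] edges from [U] to [W] closes through both hubs to a cycle of
    length [d + 3].  If there is no such arc, then [U] and [W] are disjoint and
    invariant under rotation by [d]; as the graph is not the alternating wheel,
    two consecutive rim vertices share a hub, and rotating one of them yields
    an arc with [d + 1] edges that closes through this hub, again to a cycle of
    length [d + 3]. *)

Set Implicit Arguments.
Unset Strict Implicit.
Unset Printing Implicit Defensive.

Import Order.TTheory GRing.Theory Num.Theory.
Import numFieldNormedType.Exports.

(** * Cycles through the hubs *)

Lemma inZp_modE (p a b : nat) : a = b %[mod p.+1] -> inZp a = inZp b :> 'I_p.+1.
Proof. by move=> ab; apply: val_inj. Qed.

Lemma inZp_ord (p : nat) (i : 'I_p.+1) : inZp i = i.
Proof. exact: valZpK. Qed.

Lemma rim_relS (m j : nat) : rim_rel (inZp j : 'I_m.+3) (inZp j.+1).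
Proof.
have e : (j %% m.+3).+1 %% m.+3 = j.+1 %% m.+3 by rewrite -addn1 modnDml addn1.
rewrite /rim_rel /= e eqxx andbT.
apply/negP => /eqP /(congr1 val) /= /eqP.
by have := eqn_modDl j 0 1 m.+3; rewrite addn0 addn1 => ->; rewrite !modn_small.
Qed.

Section Cycles.
Variables (m : nat) (spoke : 'I_m.+3 -> bool -> bool).
Let H := hubbed_cycle spoke.

(** Positions are natural numbers reduced by [inZp], so an arc running past the last rim vertex
    needs no case distinction. *)
Definition rim_arc (i d : nat) : seq H := [seq inl (inZp t) | t <- iota i d].

Lemma rim_arc_path (i d : nat) :
  path (@sedge H) (inl (inZp i)) (rim_arc i.+1 d).
Proof.
elim: d i => [|d IH] i //=; rewrite IH andbT; exact: rim_relS.
Qed.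

Lemma last_rim_arc (i d : nat) :
  last (inl (inZp i) : H) (rim_arc i.+1 d) = inl (inZp (i + d)).
Proof. by elim: d i => [|d IH] i /=; rewrite ?addn0 // IH addnS. Qed.

Lemma rim_arc_uniq (i d : nat) : d <= m.+3 -> uniq (rim_arc i d).
Proof.
move=> dm; rewrite map_inj_in_uniq ?iota_uniq // => a b.
rewrite !mem_iota => /andP[ia aid] /andP[ib bid] [h].
(* Equal remainders with different quotients would put [a] and [b] at least [m.+3] apart, too far
   for a window of length [d]. *)
have := divn_eq a m.+3; have := divn_eq b m.+3; rewrite h => eb ea.
case: (ltngtP (a %/ m.+3) (b %/ m.+3)) => [lt|lt|eq]; last by rewrite eq -eb in ea.
  by have := leq_mul lt (leqnn m.+3); rewrite mulSn; lia.
by have := leq_mul lt (leqnn m.+3); rewrite mulSn; lia.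
Qed.

Lemma hub_notin_rim_arc (b : bool) (i d : nat) : (inr b : H) \notin rim_arc i d.
Proof. by apply/mapP => -[]. Qed.

Lemma one_hub_cycle (b : bool) (i d : nat) :
  0 < d < m.+3 -> spoke (inZp i) b -> spoke (inZp (i + d)) b ->
  exists2 c : seq H, graph_cycle c & size c = d.+2.
Proof.
move=> /andP[d0 dm] si sid.
exists (rcons (rim_arc i d.+1) (inr b)); last by rewrite size_rcons size_map size_iota.
split; first by rewrite size_rcons size_map size_iota.
rewrite /ucycle rcons_uniq hub_notin_rim_arc rim_arc_uniq // andbT /=.
by rewrite !rcons_path rim_arc_path last_rim_arc last_rcons /= sid si.
Qed.

(** For [d = 0] this is the triangle formed by the hubs and a rim vertex adjacent to both. *)
Lemma two_hub_cycle (b : bool) (i d : nat) :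
  d < m.+3 -> spoke (inZp i) b -> spoke (inZp (i + d)) (~~ b) ->
  exists2 c : seq H, graph_cycle c & size c = d.+3.
Proof.
move=> dm si sid.
exists (rcons (rcons (rim_arc i d.+1) (inr (~~ b))) (inr b)).
  split; first by rewrite !size_rcons size_map size_iota.
  rewrite /ucycle !rcons_uniq mem_rcons inE negb_or !hub_notin_rim_arc rim_arc_uniq //.
  rewrite !andbT /= !rcons_path rim_arc_path last_rim_arc !last_rcons /= sid si.
  by case: b {si sid}.
by rewrite !size_rcons size_map size_iota.
Qed.

Hypothesis spoke_ex : forall i, exists b, spoke i b.
Hypothesis hub_ex : forall b, exists i, spoke i b.

(* Failure of two-hub cycles of length [d + 3] makes the neighbourhoods of the
   hubs invariant under rotation by [d], hence disjoint. *)
Lemma spoke_shift (d j : nat) :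
  (forall i, ~~ (spoke (inZp i) true && spoke (inZp (i + d)) false)) ->
  (spoke (inZp (j + d)) true = spoke (inZp j) true)
  * (spoke (inZp j) false = ~~ spoke (inZp j) true).
Proof.
move=> no2.
have step i : spoke (inZp i) true -> spoke (inZp (i + d)) true.
  move=> si; have := no2 i; rewrite si /= => /negbTE ns.
  by have [[] //] := spoke_ex (inZp (i + d)); rewrite ns.
have steps k i : spoke (inZp i) true -> spoke (inZp (i + k * d)) true.
  elim: k => [|k IH] si; first by rewrite addn0.
  by rewrite mulSn addnCA addnC -addnA; rewrite addnA; apply: step; apply: IH.
(* Rotation by [d] has finite order: [m.+2] further steps after the first make [m.+3 * d], which is
   0 modulo the rim length. *)
have back i : spoke (inZp (i + d)) true -> spoke (inZp i) true.
  move=> si; have := steps m.+2 _ si.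
  rewrite -addnA -mulSn (@inZp_modE _ _ i) //.
  by rewrite mulnC addnC modnMDl.
split; first by apply/idP/idP; [apply: back | apply: step].
apply/idP/idP.
  (* If [j] saw both hubs, then [j + m.+2 * d] would see [true], and the next step by [d] returns to
     [j], which sees [false]. *)
  move=> sj; apply/negP => sj1.
  have := no2 (j + m.+2 * d); rewrite (steps m.+2 _ sj1) /= -addnA addnC.
  rewrite [m.+2 * d + d]addnC -mulSn (@inZp_modE _ _ j) ?sj //.
  by rewrite mulnC modnMDl.
by move=> nsj; have [[] //] := spoke_ex (inZp j); rewrite (negbTE nsj).
Qed.

Lemma alternating_hubbed_cycle :
  (forall j, spoke (inZp j) false = ~~ spoke (inZp j) true) ->
  (forall j, spoke (inZp j.+1) true = ~~ spoke (inZp j) true) ->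
  ~~ odd m.+3 /\ sg_iso H (alternating_wheel m.+3.+2).
Proof.
move=> compl alt.
have altE j : spoke (inZp j) true = spoke (inZp 0) true (+) odd j.
  by elim: j => [|j IH]; rewrite ?addbF // alt IH /= addbN.
(* Going once around the rim must restore the initial value, so the number of alternations is
   even. *)
have even_m : ~~ odd m.+3.
  have := altE m.+3; rewrite (@inZp_modE _ m.+3 0) ?modnn ?mod0n //.
  by case: (odd m.+3) => //; case: spoke.
split=> //.
(* The isomorphism fixes the rim; [c] tells whether the hubs have to be swapped. *)
pose c := ~~ spoke (inZp 0) true.
have spokeE i b : spoke i b = (odd i.+1 == b (+) c).
  rewrite -[i in LHS]inZp_ord; case: b; rewrite ?compl altE /c /=;
  by case: spoke; case: odd.
exists (fun x : H => match x with inl i => inl i | inr b => inr (b (+) c) end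
          : alternating_wheel m.+3.+2).
  by exists (fun x : alternating_wheel m.+3.+2 =>
     match x with inl i => inl i | inr b => inr (b (+) c) end : H);
  case=> // b; rewrite -addbA addbb addbF.
case=> [i|b] [j|b'] //=; rewrite -?spokeE //.
by case: b; case: b'; case: (c).
Qed.

Lemma hubbed_cycle_pancyclic :
  ~ (~~ odd m.+3 /\ sg_iso H (alternating_wheel m.+3.+2)) -> pancyclic H.
Proof.
move=> nalt k; rewrite card_sum card_ord card_bool addn2 => /andP[k3 km].
have [d kE] : exists d, k = d.+3 by exists (k - 3); lia.
have {km} dm : d < m.+3 by lia.
rewrite {}kE {k k3}.
have [[i]|no2] :=
  pselect (exists i, spoke (inZp i) true && spoke (inZp (i + d)) false).
  by move=> /andP[]; apply: two_hub_cycle.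
have {}no2 i : ~~ (spoke (inZp i) true && spoke (inZp (i + d)) false).
  by apply/negP => h; apply: no2; exists i.
have shift i : spoke (inZp (i + d)) true = spoke (inZp i) true.
  by rewrite (spoke_shift _ no2).
have compl i : spoke (inZp i) false = ~~ spoke (inZp i) true.
  by rewrite (spoke_shift i no2).
(* If no two consecutive rim vertices shared a hub, complementarity would make the spokes
   alternate. *)
have [j [b [sj sj1]]] : exists j b, spoke (inZp j) b /\ spoke (inZp j.+1) b.
  apply: contrapT => no1; apply: nalt; apply: alternating_hubbed_cycle => // j.
  apply/idP/idP => [sj1|nsj].
    by apply/negP => sj; apply: no1; exists j, true.
  apply: contrapT => /negP nsj1; apply: no1.
  by exists j, false; rewrite !compl.
have shiftb i : spoke (inZp (i + d)) b = spoke (inZp i) b.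
  by case: b {sj sj1}; rewrite ?compl shift.
(* An arc with [d.+1] edges is a path only if [d.+1 < m.+3]. In the remaining case rotation by [d]
   is rotation by -1, so one hub would see the whole rim and the other nothing. *)
move: dm; rewrite leq_eqVlt => /orP[/eqP[dE]|dm].
  have rot i b' : spoke (inZp i.+1) b' = spoke (inZp i) b'.
    have rotT l : spoke (inZp l.+1) true = spoke (inZp l) true.
      rewrite -shift dE (@inZp_modE _ _ l) //.
      by rewrite addSnnS modnDr.
    by case: b'; rewrite ?compl rotT.
  have const i b' : spoke (inZp i) b' = spoke (inZp 0) b'.
    by elim: i => // i; rewrite rot.
  have [i0] := hub_ex true; have [i1] := hub_ex false.
  by rewrite -(inZp_ord i0) -(inZp_ord i1) const compl !const => /negbTE->.
apply: (@one_hub_cycle b j d.+1) => //.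
by rewrite addnS -addSn shiftb.
Qed.

End Cycles.

(** * Straight-line drawings *)

Section StraightLine.
Variable R : realType.
Local Open Scope ring_scope.

Definition segment (a b : R * R) (t : R) : R * R :=
  ((1 - t) * a.1 + t * b.1, (1 - t) * a.2 + t * b.2).

Definition affine (f : R * R * R) (a : R * R) : R :=
  f.1.1 * a.1 + f.1.2 * a.2 + f.2.

(** Weak separation of two segments by a line. The last inequality says that the four ends are not
    all on the line; common ends, or one segment inside the line, remain possible. *)
Definition separated (a b c d : R * R) : Prop :=
  exists f, [/\ affine f a <= 0, affine f b <= 0, 0 <= affine f c,
    0 <= affine f d & affine f a + affine f b < affine f c + affine f d].

Lemma separatedC a b c d : separated a b c d -> separated c d a b.
Proof.
move=> [[[p q] r] []]; rewrite /affine /= => h1 h2 h3 h4 h5.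
by exists (- p, - q, - r); split; rewrite /affine /=; lra.
Qed.

Lemma separated_swapl a b c d : separated a b c d -> separated b a c d.
Proof. by move=> [f [? ? ? ? ?]]; exists f; split=> //; lra. Qed.

Lemma separated_swapr a b c d : separated a b c d -> separated a b d c.
Proof. by move=> [f [? ? ? ? ?]]; exists f; split=> //; lra. Qed.

Lemma affine_segment f a b t :
  affine f (segment a b t) = (1 - t) * affine f a + t * affine f b.
Proof. by rewrite /affine /segment /=; ring. Qed.

(** At a common point [f] is both nonpositive and nonnegative, hence zero. The weights of interior
    points are positive, so [f] vanishes at all four ends, against the strict inequality. *)
Lemma separated_disjoint a b c d t t' : separated a b c d ->
  0 < t < 1 -> 0 < t' < 1 -> segment a b t <> segment c d t'.
Proof.
move=> [f [ha hb hc hd lt]] /andP[t0 t1] /andP[t'0 t'1] /(congr1 (affine f)).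
rewrite !affine_segment => e.
have ? : 0 <= (1 - t) * - affine f a by apply: mulr_ge0; lra.
have ? : 0 <= t * - affine f b by apply: mulr_ge0; lra.
have ? : 0 <= (1 - t') * affine f c by apply: mulr_ge0; lra.
have ? : 0 <= t' * affine f d by apply: mulr_ge0; lra.
have zero (s x : R) : 0 < s -> s * x = 0 -> x = 0.
  by move=> s0 /eqP; rewrite mulf_eq0 gt_eqF //= => /eqP.
have : affine f a = 0 by apply: (zero (1 - t)); lra.
have : affine f b = 0 by apply: (zero t); lra.
have : affine f c = 0 by apply: (zero (1 - t')); lra.
have : affine f d = 0 by apply: (zero t'); lra.
by lra.
Qed.

Lemma segment_inj a b : a != b -> injective (segment a b).
Proof.
move=> ab t t' [e1 e2]; apply/eqP; rewrite -subr_eq0; apply: contraNT ab => tt'.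
have zero (x y : R) : (1 - t) * x + t * y = (1 - t') * x + t' * y -> x = y.
  move=> e; apply/eqP; rewrite -subr_eq0; apply/eqP.
  have /eqP : (t - t') * (x - y) = 0 by lra.
  by rewrite mulf_eq0 (negbTE tt') /= => /eqP.
by case: a b e1 e2 => [a1 a2] [b1 b2] /= /zero -> /zero ->.
Qed.

Lemma straight_line_planar (G : sgraph) (pt : G -> R * R) :
  injective pt ->
  (forall x y z : G, x -- y -> z != x -> z != y ->
    separated (pt x) (pt y) (pt z) (pt z)) ->
  (forall x y x' y' : G, x -- y -> x' -- y' -> [set x; y] != [set x'; y'] ->
    separated (pt x) (pt y) (pt x') (pt y')) ->
  planar R G.
Proof.
move=> pt_inj vtx_sep edge_sep.
have segmentK a t : segment a a t = a.
  by case: a => a b; rewrite /segment /=; congr pair; lra.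
have pt_neq x y : x -- y -> pt x != pt y.
  move=> xy; apply/eqP => /pt_inj e.
  by move: xy; rewrite e sedge_irrefl.
have seg0 a b : segment a b 0 = a.
  by case: a => ? ?; rewrite /segment /=; congr pair; lra.
have seg1 a b : segment a b 1 = b.
  by case: b => ? ?; rewrite /segment /=; congr pair; lra.
have line_cont (x y : R) : continuous (fun t : R => (1 - t) * x + t * y).
  move=> t; apply: cvgD; apply: cvgMr_tmp; last exact: cvg_id.
  by apply: cvgB; [exact: cvg_cst | exact: cvg_id].
exists pt, (fun x y => segment (pt x) (pt y)); split=> //.
- move=> x y xy; split=> //.
  + apply: continuous_subspaceT => t.
    exact: (cvg_pair (line_cont (pt x).1 (pt y).1 t) (line_cont (pt x).2 (pt y).2 t)).
  + by move=> s t _ _; apply: segment_inj; apply: pt_neq.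
  + by move=> t _; rewrite /segment /=; congr pair; lra.
- move=> x y z xy t; rewrite in_itv /= => /andP[t0 t1].
  have [->|zx] := eqVneq z x.
    by rewrite -[X in _ <> X](seg0 _ (pt y)) => /(segment_inj (pt_neq _ _ xy)); lra.
  have [->|zy] := eqVneq z y.
    by rewrite -[X in _ <> X](seg1 (pt x)) => /(segment_inj (pt_neq _ _ xy)); lra.
  (* The vertex is treated as a degenerate segment. *)
  rewrite -[pt z](segmentK _ t).
  by apply: separated_disjoint; [exact: vtx_sep | exact/andP | exact/andP].
- move=> x y x' y' xy xy' ne t t'; rewrite !in_itv /= => t01 t'01.
  by apply: separated_disjoint => //; apply: edge_sep.
Qed.

(** * Drawing the wheel on a parabola *)

Definition det3 (a b c : R * R) : R :=
  (b.1 - a.1) * (c.2 - a.2) - (b.2 - a.2) * (c.1 - a.1).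

(** The line through [a] and [c] serves for both claims, oriented so that [b] is on its positive
    side. With [c] a hub, this handles a spoke against a rim vertex and against another spoke of the
    same hub. *)
Lemma noncollinear_separated a b c : det3 a c b != 0 ->
  separated a c b b /\ separated a c b c.
Proof.
case: a b c => [a1 a2] [b1 b2] [c1 c2]; rewrite /det3 /= neq_lt => /orP[] h.
  by split; exists (c2 - a2, a1 - c1, - a1 * (c2 - a2) - a2 * (a1 - c1));
    split; rewrite /affine /=; lra.
by split; exists (a2 - c2, c1 - a1, - a1 * (a2 - c2) - a2 * (c1 - a1));
  split; rewrite /affine /=; lra.
Qed.

(* Rim vertices lie on a parabola, the hub [false] below all lines through two
   consecutive rim vertices and the hub [true] above them.  With [chord] the
   rim is closed and [true] lies inside the convex rim polygon; without it the
   two hubs are joined along the line [x = -1]. *)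
Definition wheel_pt (chord : bool) (m : nat) (p : nat + bool) : R * R :=
  match p with
  | inl i => (i%:R, i%:R ^+ 2)
  | inr true => if chord then (1, 3 / 2) else (-1, 0)
  | inr false => (-1, - (m%:R + 1) ^+ 2)
  end.

(** Each edge is listed in one orientation only, so distinct edges can be told apart as ordered
    pairs. *)
Inductive drawn_edge (chord : bool) (m : nat) : nat + bool -> nat + bool -> Prop :=
| RimEdge i : (i.+1 < m)%N -> drawn_edge chord m (inl i) (inl i.+1)
| ChordEdge : chord -> drawn_edge chord m (inl 0%N) (inl m.-1)
| SpokeEdge i b : (i < m)%N -> drawn_edge chord m (inl i) (inr b)
| HubEdge : ~~ chord -> drawn_edge chord m (inr true) (inr false).

(** The secant of the parabola through its points at [j] and [j.+1]. On the rim it takes products of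
    two consecutive integers as values, which are never negative. *)
Definition rim_line (j : nat) : R * R * R :=
  (- (2 * j%:R + 1), 1, j%:R * (j%:R + 1)).

Lemma rim_line_rim c m j i :
  affine (rim_line j) (wheel_pt c m (inl i)) = (i%:R - j%:R) * (i%:R - j%:R - 1).
Proof. by rewrite /affine /=; ring. Qed.

Lemma rim_line_ge0 c m j i : 0 <= affine (rim_line j) (wheel_pt c m (inl i)).
Proof.
rewrite rim_line_rim; case: (leqP i j) => [|] ij.
  by have : i%:R <= j%:R :> R by [rewrite ler_nat]; nra.
by have : j.+1%:R <= i%:R :> R by [rewrite ler_nat]; rewrite -natr1; nra.
Qed.

Lemma rim_line_gt0 c m j i : i != j -> i != j.+1 ->
  0 < affine (rim_line j) (wheel_pt c m (inl i)).
Proof.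
move=> ij ij1; rewrite lt_neqAle rim_line_ge0 andbT eq_sym rim_line_rim.
rewrite mulf_neq0 //; first by rewrite subr_eq0 eqr_nat.
by rewrite -addrA -opprD natr1 subr_eq0 eqr_nat.
Qed.

Lemma rim_line_eq0 c m j : affine (rim_line j) (wheel_pt c m (inl j)) = 0.
Proof. by rewrite rim_line_rim subrr mul0r. Qed.

Lemma rim_line_eq0S c m j : affine (rim_line j) (wheel_pt c m (inl j.+1)) = 0.
Proof. by rewrite rim_line_rim -natr1; ring. Qed.

Lemma rim_line_top c m j : 0 < affine (rim_line j) (wheel_pt c m (inr true)).
Proof.
have j0 : 0 <= j%:R :> R by [].
case: c; rewrite /affine /=; last by nra.
case: j j0 => [|[|j]] /= j0; [lra | lra |].
have := ler0n R j; rewrite -[j.+2%:R]natr1 -[j.+1%:R]natr1; nra.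
Qed.

(** The index [j = m.-1] is included: its secant runs through the last rim vertex and a point beyond
    the rim, so each rim vertex has a line that separates the hubs. *)
Lemma rim_line_bottom c m j :
  (j < m)%N -> affine (rim_line j) (wheel_pt c m (inr false)) < 0.
Proof.
move=> jm; have j0 : 0 <= j%:R :> R by [].
have : j.+1%:R <= m%:R :> R by rewrite ler_nat.
by rewrite /affine /= -natr1; nra.
Qed.

Lemma det3_hub c m i j b : (2 < m)%N -> (i < m)%N -> (j < m)%N -> i != j ->
  det3 (wheel_pt c m (inl i)) (wheel_pt c m (inr b)) (wheel_pt c m (inl j)) != 0.
Proof.
move=> m2 im jm ij.
pose h := wheel_pt c m (inr b).
have -> : det3 (wheel_pt c m (inl i)) h (wheel_pt c m (inl j)) =
  (i%:R - j%:R) * (h.2 - (i%:R + j%:R) * h.1 + i%:R * j%:R).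
  by rewrite /det3 /h /=; ring.
rewrite mulf_neq0 // ?subr_eq0 ?eqr_nat // {}/h.
have i0 : 0 <= i%:R :> R by [].
have j0 : 0 <= j%:R :> R by [].
case: b => /=; last first.
  have : i.+1%:R <= m%:R :> R by rewrite ler_nat.
  have : j.+1%:R <= m%:R :> R by rewrite ler_nat.
  by rewrite -!natr1 => ? ?; apply/eqP; nra.
case: c => /=; last first.
  rewrite gt_eqF //.
  have : 1 <= i%:R + j%:R :> R by rewrite -natrD ler1n; lia.
  by nra.
(* The factor is [i * j - (i + j) + 3 / 2], an integer plus one half, so it is at least 1/2 or at
   most -1/2. This is why the inner hub has height 3/2. *)
have [e|] := leqP (i + j) (i * j + 1)%N.
  have : (i + j)%:R <= (i * j + 1)%:R :> R by rewrite ler_nat.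
  by rewrite !natrD natrM => ?; rewrite gt_eqF //; nra.
move=> lt; have : (i * j + 2)%:R <= (i + j)%:R :> R by rewrite ler_nat; lia.
by rewrite !natrD natrM => ?; rewrite lt_eqF //; nra.
Qed.

(** The line through the first and last rim points; at the rim point [i] its value is
    [i * (m.-1 - i)]. *)
Definition chord_line (m : nat) : R * R * R := (m.-1%:R, -1, 0).

Lemma chord_line_ge0 c m i :
  (i < m)%N -> 0 <= affine (chord_line m) (wheel_pt c m (inl i)).
Proof.
move=> im; have i0 : 0 <= i%:R :> R by [].
have : i%:R <= m.-1%:R :> R by rewrite ler_nat; lia.
by rewrite /affine /=; nra.
Qed.

Lemma chord_line_top m :
  (2 < m)%N -> 0 < affine (chord_line m) (wheel_pt true m (inr true)).
Proof.
move=> m2; have : 2 <= m.-1%:R :> R by rewrite ler_nat; lia.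
by rewrite /affine /=; lra.
Qed.

Lemma chord_line_eq0 c m :
  (affine (chord_line m) (wheel_pt c m (inl 0%N)) = 0) *
  (affine (chord_line m) (wheel_pt c m (inl m.-1)) = 0).
Proof. by split; rewrite /affine /=; ring. Qed.

Definition wheel_pos (m : nat) (p : nat + bool) : bool :=
  if p is inl i then (i < m)%N else true.

Lemma drawn_edge_vertex_separated c m p q z : (2 < m)%N ->
  drawn_edge c m p q -> wheel_pos m z -> z <> p -> z <> q ->
  separated (wheel_pt c m p) (wheel_pt c m q) (wheel_pt c m z) (wheel_pt c m z).
Proof.
move=> m2 [i im|c1|i b im|c0] zm zp zq.
- case: z zm zp zq => [k|[]] zm zp zq.
  + have ki : k != i by apply/eqP => e; apply: zp; rewrite e.
    have ki1 : k != i.+1 by apply/eqP => e; apply: zq; rewrite e.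
    have ? := rim_line_gt0 c m ki ki1.
    by exists (rim_line i); rewrite rim_line_eq0 rim_line_eq0S; split; lra.
  + have ? := rim_line_top c m i.
    by exists (rim_line i); rewrite rim_line_eq0 rim_line_eq0S; split; lra.
  + have ? := rim_line_bottom c (ltnW im).
    by apply: separatedC; exists (rim_line i); rewrite rim_line_eq0 rim_line_eq0S; split; lra.
(* The rim line at [k] passes through [k] and leaves the end 0 of the chord strictly above it. *)
- case: z zm zp zq => [k|[]] zm zp zq.
  + have k0 : k != 0%N by apply/eqP => e; apply: zp; rewrite e.
    have := @rim_line_gt0 c m k 0%N; rewrite eq_sym => /(_ k0 isT) ?.
    have ? := rim_line_ge0 c m k m.-1.
    by apply: separatedC; exists (rim_line k); rewrite rim_line_eq0; split; lra.
  + have ? := chord_line_top m2; move: c c1 zp zq => [] // _ _ _.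
    by exists (chord_line m); rewrite !chord_line_eq0; split; lra.
  + have ? := @rim_line_bottom c m 0 (ltnW (ltnW m2)).
    have ? := rim_line_ge0 c m 0 m.-1.
    by apply: separatedC; exists (rim_line 0); rewrite rim_line_eq0; split; lra.
- case: z zm zp zq => [k|b'] zm zp zq.
    have ik : i != k by apply/eqP => e; apply: zp; rewrite e.
    by have [] := noncollinear_separated (det3_hub c b m2 im zm ik).
  have ht := rim_line_top c m i; have hb := rim_line_bottom c im.
  case: b b' {zm} zp zq => [] [] // _ _.
    by apply: separatedC; exists (rim_line i); rewrite rim_line_eq0; split; lra.
  by exists (rim_line i); rewrite rim_line_eq0; split; lra.
- case: c c0 => // _; case: z zm zp zq => [k|[]] //= zm _ _.
  have k0 := ler0n R k.
  (* The axis [x = 0]: both hubs have abscissa -1, the rim has none that is negative. *)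
  by exists (1, 0, 0); split; rewrite /affine /=; lra.
Qed.

Lemma drawn_edges_separated c m p q p' q' : (2 < m)%N ->
  drawn_edge c m p q -> drawn_edge c m p' q' -> (p, q) <> (p', q') ->
  separated (wheel_pt c m p) (wheel_pt c m q) (wheel_pt c m p') (wheel_pt c m q').
Proof.
move=> m2.
pose v x := wheel_pt c m x.
have rim_chord i : (i.+1 < m)%N ->
    separated (v (inl i)) (v (inl i.+1)) (v (inl 0%N)) (v (inl m.-1)).
  move=> im; exists (rim_line i); rewrite rim_line_eq0 rim_line_eq0S.
  have h1 := rim_line_ge0 c m i 0; have h2 := rim_line_ge0 c m i m.-1.
  (* As [m > 2], the two ends of the chord are not both on the line of one rim edge. *)
  suff : 0 < affine (rim_line i) (v (inl 0%N)) \/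
         0 < affine (rim_line i) (v (inl m.-1)) by rewrite /v => -[?|?]; split; lra.
  case: i im {h1 h2} => [|i] im; [right|left]; apply: rim_line_gt0 => //; lia.
have rim_spoke i j b : (i.+1 < m)%N -> (j < m)%N ->
    separated (v (inl i)) (v (inl i.+1)) (v (inl j)) (v (inr b)).
  move=> im jm; case: b.
    have ? := rim_line_top c m i; have ? := rim_line_ge0 c m i j.
    by exists (rim_line i); rewrite rim_line_eq0 rim_line_eq0S; split; lra.
  have ? := rim_line_bottom c jm.
  have ? := rim_line_ge0 c m j i; have ? := rim_line_ge0 c m j i.+1.
  by apply: separatedC; exists (rim_line j); rewrite rim_line_eq0; split; lra.
have rim_hub i : ~~ c ->
    separated (v (inl i)) (v (inl i.+1)) (v (inr true)) (v (inr false)).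
  rewrite /v; case: (c) => // _; have ? := ler0n R i.
  by apply: separatedC; exists (1, 0, 0); split; rewrite /affine /= -?natr1; lra.
have chord_spoke i b : c -> (i < m)%N ->
    separated (v (inl 0%N)) (v (inl m.-1)) (v (inl i)) (v (inr b)).
  rewrite /v; case: (c) => // _ im; case: b.
    have ? := chord_line_top m2; have ? := chord_line_ge0 true im.
    by exists (chord_line m); rewrite !chord_line_eq0; split; lra.
  have ? := rim_line_bottom true im.
  have ? := rim_line_ge0 true m i 0; have ? := rim_line_ge0 true m i m.-1.
  by apply: separatedC; exists (rim_line i); rewrite rim_line_eq0; split; lra.
(* Spokes of different hubs are separated by the rim line at the rim end of the lower one. *)
have top_bottom i j : (j < m)%N ->
    separated (v (inl i)) (v (inr true)) (v (inl j)) (v (inr false)).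
  move=> jm; have ? := rim_line_bottom c jm; have ? := rim_line_top c m j.
  have ? := rim_line_ge0 c m j i.
  by apply: separatedC; exists (rim_line j); rewrite rim_line_eq0; split; lra.
have spoke_hub i b : ~~ c ->
    separated (v (inl i)) (v (inr b)) (v (inr true)) (v (inr false)).
  rewrite /v; case: (c) => // _; have ? := ler0n R i.
  by apply: separatedC; exists (1, 0, 1); split; case: b; rewrite /affine /=; lra.
(* What survives automation is two rim edges and two spokes. *)
move=> [i im|c1|i b im|c0] [j jm|c1'|j b' jm|c0'] ne;
  do ?[by exfalso; apply: ne | by rewrite c1 in c0' | by rewrite c1' in c0
      | by auto | by apply: separatedC; auto].
- have ij : j%:R - i%:R != 0 :> R.
    by rewrite subr_eq0 eqr_nat; apply/eqP => e; apply: ne; rewrite e.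
  have ? := rim_line_ge0 c m i j; have ? := rim_line_ge0 c m i j.+1.
  exists (rim_line i); rewrite rim_line_eq0 rim_line_eq0S; split => //.
  (* The values at the ends of the second edge add up to [2 * (j - i) ^ 2]. *)
  rewrite !rim_line_rim -natr1.
  have : 0 < (j%:R - i%:R) ^+ 2 :> R by rewrite exprn_even_gt0.
  by nra.
- have [bb|] := eqVneq b b'; last first.
    by case: b b' {ne} => [] [] // _; auto; apply: separatedC; auto.
  subst b'; have ij : i != j by apply/eqP => e; apply: ne; rewrite e.
  by have [] := noncollinear_separated (det3_hub c b m2 im jm ij).
Qed.

Lemma drawn_planar c m (G : sgraph) (h : G -> nat + bool) : (2 < m)%N ->
  injective h -> (forall x, wheel_pos m (h x)) ->
  (forall x y : G, x -- y ->
     drawn_edge c m (h x) (h y) \/ drawn_edge c m (h y) (h x)) ->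
  planar R G.
Proof.
move=> m2 h_inj h_pos edgeP; apply: (@straight_line_planar G (wheel_pt c m \o h)).
- move=> x y /= e; apply: h_inj; move: (h x) (h y) e => [i|[]] [j|[]] //=.
  + by case=> /eqP; rewrite eqr_nat => /eqP ->.
  + case: c {edgeP} => -[] e1 e2; first by rewrite e1 in e2; exfalso; lra.
    by exfalso; have := ler0n R i; rewrite e1; lra.
  + by case=> e1; exfalso; have := ler0n R i; rewrite e1; lra.
  + case: c {edgeP} => -[] e1 e2; first by rewrite -e1 in e2; exfalso; lra.
    by exfalso; have := ler0n R j; rewrite -e1; lra.
  + case: c {edgeP} => -[e1]; exfalso; first by lra.
    by have : 0 < (m%:R + 1) ^+ 2 :> R; [rewrite exprn_gt0 // ltr_pwDr | lra].
  + by case=> e1; exfalso; have := ler0n R j; rewrite -e1; lra.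
  + case: c {edgeP} => -[e1]; exfalso; first by lra.
    by have : 0 < (m%:R + 1) ^+ 2 :> R; [rewrite exprn_gt0 // ltr_pwDr | lra].
- move=> x y z xy zx zy /=.
  have hz u : z != u -> h z <> h u by move=> zu /h_inj e; rewrite e eqxx in zu.
  case: (edgeP _ _ xy) => d; [|apply: separated_swapl];
    by apply: drawn_edge_vertex_separated => //; apply: hz.
- move=> x y x' y' xy xy' ne /=.
  have hne u w u' w' : [set u; w] != [set u'; w'] -> (h u, h w) <> (h u', h w').
    by move=> neq [/h_inj e /h_inj e']; rewrite e e' eqxx in neq.
  have ne' : [set y; x] != [set x'; y'] by rewrite finset.setUC.
  have ne'' : [set x; y] != [set y'; x'] by rewrite [X in _ != X]finset.setUC.
  have ne3 : [set y; x] != [set y'; x'] by rewrite finset.setUC.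
  case: (edgeP _ _ xy) => d; [|apply: separated_swapl];
    (case: (edgeP _ _ xy') => d'; [|apply: separated_swapr]);
    by apply: drawn_edges_separated => //; apply: hne.
Qed.

End StraightLine.

(** * Spanning subgraphs of the bicycle wheel *)

(** Deleting the neighbourhood of [x] isolates [x]; if fewer than [k] vertices were deleted, no
    other vertex can remain. *)
Lemma k_connected_small_degree (k : nat) (G : sgraph) (x y : G) :
  k_connected k G -> #|[set z | x -- z]| < k -> y != x -> x -- y.
Proof.
move=> [_ conn] deg; apply: contraNT => nxy.
have xX : x \notin [set z | x -- z] by rewrite inE sedge_irrefl.
have yX : y \notin [set z | x -- z] by rewrite inE.
have /connectP[[|z p] /= pth ->] := conn _ deg _ _ xX yX; first by [].
by move: pth; rewrite !inE => /andP[/and3P[-> _]].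
Qed.

Lemma rim_relE (m : nat) (i j : 'I_m.+3) :
  rim_rel i j = (j == inZp i.+1) || (i == inZp j.+1).
Proof.
rewrite /rim_rel /= -!val_eqE /= andb_idl // => ij; apply/negP => /eqP eij.
have := rim_relS m i; rewrite inZp_ord /rim_rel /= -val_eqE /=.
by move: ij; rewrite -eij orbb => /eqP <-; rewrite eqxx.
Qed.

(** Rotation brings a missing rim edge to the place between the last position and 0, the only rim
    edge that the drawing can omit. *)
Definition rim_rot (m s : nat) (p : 'I_m.+3 + bool) : nat + bool :=
  match p with inl i => inl ((i + s) %% m.+3) | inr b => inr b end.

Lemma rim_rot_inj (m s : nat) : injective (@rim_rot m s).
Proof.
move=> [i|b] [j|b'] //= [] => [/eqP|-> //].
by rewrite eqn_modDr !modn_small // => /eqP/val_inj ->.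
Qed.

Lemma rim_rotS (m s : nat) (i : 'I_m.+3) :
  rim_rot s (inl (inZp i.+1 : 'I_m.+3)) = inl (((i + s) %% m.+3).+1 %% m.+3).
Proof.
by rewrite /= modnDml addSn -[in RHS]addn1 modnDml addn1.
Qed.

Section SpanningSubgraph.
Variables (R : realType) (m : nat) (G : sgraph).
Variables (f : G -> 'I_m.+3 + bool) (g : 'I_m.+3 + bool -> G).
Hypotheses (fK : cancel f g) (gK : cancel g f).
Hypothesis sub : forall p q, g p -- g q -> hubbed_rel (fun _ _ => true) p q.

Lemma rim_step_drawn (c : bool) (s : nat) (i : 'I_m.+3) :
  c \/ (i + s) %% m.+3 != m.+2 ->
  let p := rim_rot s (inl i) in let q := rim_rot s (inl (inZp i.+1 : 'I_m.+3)) in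
  drawn_edge c m.+3 p q \/ drawn_edge c m.+3 q p.
Proof.
move=> nc /=; have := rim_rotS s i => /= -[->].
have := ltn_pmod (i + s) (isT : 0 < m.+3).
move: ((i + s) %% m.+3) nc => a nc; rewrite ltnS leq_eqVlt => /orP[/eqP e|lt].
  right; rewrite e modnn; case: nc => [c1|]; last by rewrite e eqxx.
  exact: (ChordEdge m.+3 c1).
by left; rewrite modn_small ?ltnS //; apply: RimEdge.
Qed.

Lemma rot_planar (c : bool) (s : nat) :
  (forall i : 'I_m.+3, g (inl i) -- g (inl (inZp i.+1)) ->
     c \/ (i + s) %% m.+3 != m.+2) ->
  (g (inr true) -- g (inr false) -> ~~ c) ->
  planar R G.
Proof.
move=> rim_ok hub_ok.
apply: (@drawn_planar R c m.+3 G (fun x => rim_rot s (f x))) => //.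
- exact: inj_comp (@rim_rot_inj m s) (can_inj fK).
- by move=> x; case: (f x) => //= i; rewrite ltn_pmod.
move=> x y; rewrite -[x]fK -[y]fK !gK => xy; have := sub xy.
case: (f x) (f y) xy => [i|b] [j|b'] xy; rewrite /hubbed_rel.
- rewrite rim_relE => /orP[] /eqP e.
    by rewrite e; apply: rim_step_drawn; apply: rim_ok; rewrite -e.
  rewrite e; apply/or_comm; apply: rim_step_drawn; apply: rim_ok.
  by rewrite -e sedge_sym.
- by move=> _; left; apply: SpokeEdge; rewrite ltn_pmod.
- by move=> _; right; apply: SpokeEdge; rewrite ltn_pmod.
- have hub : g (inr true) -- g (inr false) -> drawn_edge c m.+3 (inr true) (inr false).
    by move/hub_ok; apply: HubEdge.
  by case: b b' xy => [] [] // xy _; [left|right; rewrite sedge_sym in xy]; apply: hub.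
Qed.

Lemma nonplanar_hub_edge : ~ planar R G -> g (inr true) -- g (inr false).
Proof.
move=> npl; apply: contrapT => nuw; apply: npl.
by apply: (@rot_planar true 0) => [|/nuw //]; left.
Qed.

Lemma nonplanar_rim_edge (i : 'I_m.+3) :
  ~ planar R G -> g (inl i) -- g (inl (inZp i.+1)).
Proof.
move=> npl; apply: contrapT => ni; apply: npl.
(* This shift sends [i] to the last position [m.+2], and injectivity shows that no other rim vertex
   lands there. *)
apply: (@rot_planar false (m.+2 - i)) => // j jE; right; apply/negP => /eqP e.
apply: ni; suff <- : j = i by [].
have im : i <= m.+2 by rewrite -ltnS.
have : rim_rot (m.+2 - i) (inl j) = rim_rot (m.+2 - i) (inl i).
  by rewrite /= e subnKC // modn_small.
by move/rim_rot_inj => -[].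
Qed.

Lemma nonplanar_hubbed_cycle : ~ planar R G ->
  sg_iso G (hubbed_cycle (fun i b => g (inl i) -- g (inr b))).
Proof.
move=> npl; exists f; first by exists g.
move=> x y; rewrite -[in RHS](fK x) -[in RHS](fK y).
case: (f x) (f y) => [i|b] [j|b'] //=.
- apply/idP/idP; last exact: sub.
  rewrite rim_relE => /orP[/eqP ->|/eqP ->]; last rewrite sedge_sym;
  exact: nonplanar_rim_edge.
- exact: sedge_sym.
- have hub := nonplanar_hub_edge npl.
  case: b b' => [] [] /=; rewrite ?sedge_irrefl ?hub //.
  by rewrite sedge_sym hub.
Qed.

Lemma three_connected_rim_spoke (i : 'I_m.+3) :
  k_connected 3 G -> exists b, g (inl i) -- g (inr b).
Proof.
(* Without spokes only the two rim neighbours [i.+1] and [i + m.+2] could be left. Such a small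
   degree makes every other vertex a neighbour, in particular the hub [true]. *)
move=> conn; apply: contrapT => nsp; apply: (nsp); exists true.
apply: (k_connected_small_degree conn); last by rewrite (can_eq gK).
apply: (@leq_ltn_trans #|[set g (inl (inZp i.+1)); g (inl (inZp (i + m.+2)))]|).
  apply: subset_leq_card; apply/fintype.subsetP => z; rewrite -[z]fK !inE.
  case: (f z) => [j|b] e; last by case: nsp; exists b.
  have := sub e; rewrite /= rim_relE !(can_eq gK) => /orP[/eqP->|/eqP ij].
    by rewrite eqxx.
  apply/orP; right; apply/eqP; congr inl; apply: val_inj; rewrite ij /=.
  by rewrite modnDml addSnnS modnDr modn_small.
by rewrite cards2; case: eqP.
Qed.

Lemma three_connected_hub_spoke (b : bool) :
  k_connected 3 G -> exists i, g (inl i) -- g (inr b).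
Proof.
move=> conn; apply: contrapT => nsp; apply: (nsp); exists ord0.
rewrite sedge_sym; apply: (k_connected_small_degree conn); last by rewrite (can_eq gK).
(* A hub without spokes has at most the other hub as neighbour. *)
apply: (@leq_ltn_trans #|[set g (inr (~~ b))]|); last by rewrite cards1.
apply: subset_leq_card; apply/fintype.subsetP => z; rewrite -[z]fK !inE.
case: (f z) => [j|b'] e; first by case: nsp; exists j; rewrite sedge_sym.
by have := sub e; rewrite (can_eq gK) /=; case: b b' {e nsp} => [] [].
Qed.

End SpanningSubgraph.

Lemma B_graph_hubbed_cycle (R : realType) (m : nat) (G : sgraph) :
  B_graph R G -> #|G| = m.+3.+2 ->
  exists spoke : 'I_m.+3 -> bool -> bool,
    [/\ sg_iso G (hubbed_cycle spoke), forall i, exists b, spoke i b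
      & forall b, exists i, spoke i b].
Proof.
move=> [n n5 GB] cardG.
(* The wheel size hidden in [B_graph] is recovered by counting vertices. *)
have nE (f : G -> 'I_(n - 2) + bool) : bijective f -> n = m.+3.+2.
  by move=> /bij_eq_card; rewrite cardG card_sum card_ord card_bool; lia.
case: GB => [[f f_bij fE]|[conn npl [F _ [f f_bij fE]]]].
  have e := nE f f_bij; subst n.
  exists (fun _ _ => true); split; [by exists f | by exists true | by exists ord0].
have e := nE f f_bij; subst n; case: f_bij => g fK gK.
have sub p q : g p -- g q -> hubbed_rel (fun _ _ => true) p q.
  by rewrite -fE !gK => /andP[].
exists (fun i b => g (inl i) -- g (inr b)); split.
- exact: nonplanar_hubbed_cycle npl.
- by move=> i; apply: three_connected_rim_spoke conn.
- by move=> b; apply: three_connected_hub_spoke conn.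
Qed.

(** * Transport along isomorphisms and conclusion *)

Lemma sg_iso_sym (G H : sgraph) : sg_iso G H -> sg_iso H G.
Proof.
move=> [f [g fK gK] fE]; exists g; first by exists f.
by move=> x y; rewrite -fE !gK.
Qed.

Lemma sg_iso_trans (G H K : sgraph) : sg_iso G H -> sg_iso H K -> sg_iso G K.
Proof.
move=> [f f_bij fE] [h h_bij hE]; exists (h \o f); first exact: bij_comp.
by move=> x y /=; rewrite hE fE.
Qed.

Lemma pancyclic_iso (G H : sgraph) : sg_iso G H -> pancyclic G -> pancyclic H.
Proof.
move=> [f f_bij fE] panG k; rewrite -(bij_eq_card f_bij) => /panG.
move=> [c [c3 /andP[cyc uc]] ck]; exists (map f c); last by rewrite size_map.
split; first by rewrite size_map.
rewrite /ucycle (map_inj_uniq (bij_inj f_bij)) uc andbT cycle_map.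
by rewrite (eq_cycle (e' := @sedge G)).
Qed.

Theorem theorem8 (R : realType) (n : nat) (G : sgraph) :
  5 <= n -> B_graph R G -> #|G| = n ->
  ~ (~~ odd n /\ sg_iso G (alternating_wheel n)) ->
  pancyclic G.
Proof.
move=> n5 GB cardG nalt.
have [m nE] : exists m, n = m.+3.+2 by exists (n - 5); lia.
subst n; have [spoke [GH spoke_ex hub_ex]] := B_graph_hubbed_cycle GB nE.
rewrite nE in nalt.
apply: (pancyclic_iso (sg_iso_sym GH)).
apply: hubbed_cycle_pancyclic => // -[odd_m alt]; apply: nalt; split.
  by move: odd_m; rewrite /= !negbK.
exact: sg_iso_trans alt.
Qed.
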